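(* Let $\phi=\frac{1+\sqrt5}{2}$ be the golden ratio. Then for every integer $k\ge 1$ $$F_{k}=\sum_{m=0}^{k-1}(-1)^{m}\phi^{k-2m-1}.$$
   Context: $\{F_k\}_{k\ge 0}$ is the Fibonacci sequence: $F_0=0$, $F_1=1$, $F_{k+1}=F_k+F_{k-1}$ for $k\ge 1$. The exponents $k-2m-1$ are integers, possibly negative. *)

(* Defs.v *)
From mathcomp Require Import all_boot all_order all_algebra.
From mathcomp Require Import reals.

Set Implicit Arguments.
Unset Strict Implicit.
Unset Printing Implicit Defensive.

Import Order.TTheory GRing.Theory Num.Theory.
Local Open Scope ring_scope.

Fixpoint fib (n : nat) : nat :=
  match n with
  | 0 => 0
  | n1.+1 => match n1 with
             | 0 => 1
             | n2.+1 => fib n1 + fib n2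
             end
  end%N.

Definition golden_ratio (R : realType) : R := (1 + Num.sqrt 5) / 2.

(* Main.v *)
Require Import Defs.
From mathcomp Require Import all_boot all_order all_algebra.
From mathcomp Require Import reals ring.

(** Put [psi = - phi^-1], the conjugate root of [x ^+ 2 = x + 1].  The summand
    [(-1) ^+ m * phi ^ (k - 2 m - 1)] is [phi ^+ (k - 1 - m) * psi ^+ m], so the
    sum is the complete homogeneous form behind Binet's quotient
    [(phi ^+ k - psi ^+ k) / (phi - psi)].  Both sides start at [0] and satisfy
    the first-order recurrence [u (k + 1) = phi * u k + psi ^+ k]: for the sum
    this is a shift of exponents ([sum_altexpzS]), while for the Fibonacci
    numbers it follows from [phi + psi = 1] and [psi ^+ 2 = psi + 1]
    ([fibS_roots]).  Hence they agree for every [k]. *)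

Import Order.TTheory GRing.Theory Num.Theory.
Local Open Scope ring_scope.

Lemma golden_ratio_sqr (R : realType) :
  golden_ratio R ^+ 2 = golden_ratio R + 1.
Proof.
have s5 : Num.sqrt (5 : R) ^+ 2 = 5 by rewrite sqr_sqrtr.
rewrite /golden_ratio; move: (Num.sqrt _) s5 => s s5.
by rewrite expr_div_n sqrrD s5; field.
Qed.

Lemma golden_ratio_neq0 (R : realType) : golden_ratio R != 0.
Proof.
apply/eqP => phi0; have := golden_ratio_sqr R.
by rewrite phi0 expr0n add0r => /esym/eqP; rewrite oner_eq0.
Qed.

(** The first-order form of the Fibonacci recurrence: two consecutive instances
    add up to the next one because [b] is itself a root of
    [x ^+ 2 = x + 1]. *)
Lemma fibS_roots (R : comNzRingType) (a b : R) (n : nat) :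
  a + b = 1 -> b ^+ 2 = b + 1 ->
  (fib n.+1)%:R = a * (fib n)%:R + b ^+ n.
Proof.
move=> ab1 b2.
suff [] : (fib n.+1)%:R = a * (fib n)%:R + b ^+ n /\
          (fib n.+2)%:R = a * (fib n.+1)%:R + b ^+ n.+1 by [].
elim: n => [|n [IH0 IH1]]; first by rewrite /= mulr0 add0r mulr1 expr1 ab1.
split=> //.
have fibSS m : (fib m.+2)%:R = (fib m.+1)%:R + (fib m)%:R :> R.
  by rewrite -natrD.
rewrite fibSS {1}IH1 {2}IH0 (fibSS n).
have -> : b ^+ n.+2 = b ^+ n.+1 + b ^+ n.
  by rewrite -addn2 exprD b2 mulrDr mulr1 -exprSr.
by ring.
Qed.

(** Raising [k] by one multiplies each old term by [x]; the new last term
    [m = k] has exponent [(k + 1) - 2 k - 1 = - k]. *)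
Lemma sum_altexpzS (F : fieldType) (x : F) (k : nat) : x != 0 ->
  \sum_(0 <= m < k.+1) (-1) ^+ m * x ^ (k.+1%:Z - 2 * m%:Z - 1) =
  x * (\sum_(0 <= m < k) (-1) ^+ m * x ^ (k%:Z - 2 * m%:Z - 1))
  + (- x^-1) ^+ k.
Proof.
move=> x0; rewrite big_nat_recr //= big_distrr /=; congr (_ + _).
  apply: eq_bigr => m _; rewrite mulrCA; congr (_ * _).
  have -> : k.+1%:Z - 2 * m%:Z - 1 = 1 + (k%:Z - 2 * m%:Z - 1).
    by rewrite -addn1 PoszD; ring.
  by rewrite (expfzDr 1) // expr1z.
have -> : k.+1%:Z - 2 * k%:Z - 1 = - k%:Z by rewrite -addn1 PoszD; ring.
by rewrite -exprz_inv -exprnP -exprMn mulN1r.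
Qed.

Theorem corollary4p8 (R : realType) (k : nat) (hk : (1 <= k)%N) :
  (fib k)%:R =
  \sum_(0 <= m < k)
    (-1) ^+ m * golden_ratio R ^ (k%:Z - 2 * m%:Z - 1).
Proof.
have phi0 := golden_ratio_neq0 R; have phi2 := golden_ratio_sqr R.
set phi := golden_ratio R in phi0 phi2 *.
(* The relation phi ^+ 2 = phi + 1, divided by phi. *)
have phiV : phi^-1 = phi - 1.
  by apply: (mulfI phi0); rewrite mulfV // mulrBr mulr1 -expr2 phi2 addrC addKr.
have sum_roots : phi + - phi^-1 = 1 by rewrite phiV; ring.
have psi2 : (- phi^-1) ^+ 2 = - phi^-1 + 1.
  by rewrite phiV sqrrN sqrrB phi2; ring.
(* The recurrence is anchored at the empty sum k = 0. *)
elim: k {hk} => [|k IHk]; first by rewrite big_nil.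
by rewrite sum_altexpzS // -IHk; apply: fibS_roots.
Qed.
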